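(* Let $A:\mathbb R\to\mathbb R^{n\times n}$ be continuous with $\sup_{t}\|A(t)\|=\mu<\infty$; let $f:\mathbb R\times\mathbb R^n\times\mathbb R^n\to\mathbb R^n$ be continuous in its first argument with $f(t,0,0)=0$ and $\|f(t,y_1,w_1)-f(t,y_2,w_2)\|\le l(\|y_1-y_2\|+\|w_1-w_2\|)$; let $x'=A(t)x$ have an exponential dichotomy on $\mathbb R$ with constants $K,\sigma>0$; and let $lM\theta[1+M(1+l\theta)e^{Ml\theta}]<m$, where $M=e^{\mu\theta}$, $m=e^{-\mu\theta}$. Fix $N>0$, $\alpha\in(0,\sigma)$ and $t_0\in\mathbb R$. A function $z(t)=(u(t),v(t))$ with $\|z(t)\|\le Ne^{\alpha(t-t_0)}$ for $t\le t_0$ is a solution on $\mathbb R$ of the reduced system $$u'=B_+(t)u+g_+(t,z(t),z(\beta(t))),\qquad v'=B_-(t)v+g_-(t,z(t),z(\beta(t)))$$ if and only if it is a solution of the system of integral equations $$u(t)=\int_{-\infty}^tU(t,s)g_+(s,z(s),z(\beta(s)))\,ds,\qquad v(t)=V(t,t_0)v(t_0)+\int_{t_0}^tV(t,s)g_-(s,z(s),z(\beta(s)))\,ds .$$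
   Context: $\|\cdot\|$ is the Euclidean norm and the induced operator norm. $(\theta_i)_{i\in\mathbb Z}$ is a strictly increasing real sequence with $|\theta_i|\to\infty$ as $|i|\to\infty$ and $\theta_{i+1}-\theta_i\le\theta$ for all $i$, where $\theta>0$; $\beta(t)=\theta_i$ for $\theta_i\le t<\theta_{i+1}$. Exponential dichotomy: for a fundamental matrix $X(t)$ of $x'=A(t)x$ there is a projection $P$ with $\|X(t)PX^{-1}(s)\|\le Ke^{-\sigma(t-s)}$ for $t\ge s$ and $\|X(t)(I-P)X^{-1}(s)\|\le Ke^{-\sigma(s-t)}$ for $t\le s$. Reduced system: the equation $y'=A(t)y+f(t,y(t),y(\beta(t)))$ is transformed by $y=Q(t)z$, where $Q$ is a Lyapunov matrix ($C^1$, with $Q,Q',Q^{-1}$ bounded on $\mathbb R$) block-diagonalizing $x'=A(t)x$ according to the dichotomy, into the displayed system with $z=(u,v)$, $u\in\mathbb R^k$, $v\in\mathbb R^{n-k}$, $k=\operatorname{rank}P$, $\operatorname{diag}\{B_+,B_-\}=Q^{-1}AQ-Q^{-1}Q'$ and $(g_+,g_-)(t,z,w)=Q^{-1}(t)f(t,Q(t)z,Q(\beta(t))w)$. $U(t,s)$ and $V(t,s)$ are the fundamental matrices of $u'=B_+(t)u$ and $v'=B_-(t)v$ with $U(s,s)=I$, $V(s,s)=I$; they satisfy $\|U(t,s)\|\le Ke^{-\sigma(t-s)}$ for $t\ge s$ and $\|V(t,s)\|\le Ke^{-\sigma(s-t)}$ for $t\le s$. A solution on $\mathbb R$ of the reduced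 system is a continuous function on $\mathbb R$, differentiable except possibly at the points $\theta_i$ (where the right derivative exists), satisfying the system on every $(\theta_i,\theta_{i+1})$ and with right derivatives at the $\theta_i$. *)

(* Defs.v *)
From HB Require Import structures.
From mathcomp Require Import all_boot all_order all_algebra.
From mathcomp Require Import all_classical all_reals all_analysis.

Set Implicit Arguments.
Unset Strict Implicit.
Unset Printing Implicit Defensive.

Import Order.TTheory GRing.Theory Num.Theory.
Import numFieldNormedType.Exports.

Local Open Scope classical_set_scope.
Local Open Scope ring_scope.

(* The library norm on matrices is the max norm; its topology, which is used
   below for continuity and derivatives, is that of [enorm] and [opnorm]. *)
Definition enorm (R : realType) (n : nat) (x : 'cV[R]_n) : R :=
  Num.sqrt (\sum_(i < n) x i 0 ^+ 2).

Definition opnorm (R : realType) (p n : nat) (A : 'M[R]_(p, n)) : R :=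
  sup [set enorm (A *m x) | x in [set x : 'cV[R]_n | enorm x <= 1]].

Definition fundamental_matrix (R : realType) (n : nat)
    (A X : R -> 'M[R]_n) : Prop :=
  forall t, X t \in unitmx /\ is_derive t (1 : R) X (A t *m X t).

Definition exp_dichotomy (R : realType) (n : nat) (A X : R -> 'M[R]_n)
    (P : 'M[R]_n) (K sigma : R) : Prop :=
  [/\ fundamental_matrix A X,
      P *m P = P,
      (forall t s, s <= t ->
         opnorm (X t *m P *m invmx (X s)) <= K * expR (- sigma * (t - s))) &
      (forall t s, t <= s ->
         opnorm (X t *m (1%:M - P) *m invmx (X s))
           <= K * expR (- sigma * (s - t)))].

Definition lyapunov_matrix (R : realType) (n : nat) (Q : R -> 'M[R]_n) : Prop :=
  [/\ (forall t, Q t \in unitmx),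
      (forall t, derivable Q t 1),
      continuous (derive1 Q) &
      exists C : R, forall t,
        [/\ opnorm (Q t) <= C, opnorm (derive1 Q t) <= C
          & opnorm (invmx (Q t)) <= C]].

Definition transition_matrix (R : realType) (n : nat) (B : R -> 'M[R]_n)
    (U : R -> R -> 'M[R]_n) : Prop :=
  forall s, fundamental_matrix B (fun t => U t s) /\ U s s = 1%:M.

Definition reduced_term (R : realType) (n : nat) (Q : R -> 'M[R]_n)
    (beta : R -> R) (f : R -> 'cV[R]_n -> 'cV[R]_n -> 'cV[R]_n)
    (t : R) (z w : 'cV[R]_n) : 'cV[R]_n :=
  invmx (Q t) *m f t (Q t *m z) (Q (beta t) *m w).

Definition is_right_derive (R : realType) (n : nat) (x : R -> 'cV[R]_n)
    (t : R) (d : 'cV[R]_n) : Prop :=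
  h^-1 *: (x (t + h) - x t) @[h --> 0^'+] --> d.

Definition reduced_solution (R : realType) (k q : nat) (theta : int -> R)
    (beta : R -> R) (Bp : R -> 'M[R]_k) (Bm : R -> 'M[R]_q)
    (g : R -> 'cV[R]_(k + q) -> 'cV[R]_(k + q) -> 'cV[R]_(k + q))
    (z : R -> 'cV[R]_(k + q)) : Prop :=
  let u t := usubmx (z t) in
  let v t := dsubmx (z t) in
  let du t := Bp t *m u t + usubmx (g t (z t) (z (beta t))) in
  let dv t := Bm t *m v t + dsubmx (g t (z t) (z (beta t))) in
  [/\ continuous z,
      (forall (i : int) t, theta i < t < theta (i + 1) ->
         is_derive t (1 : R) u (du t) /\ is_derive t (1 : R) v (dv t)) &
      (forall i : int,
         is_right_derive u (theta i) (du (theta i)) /\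
         is_right_derive v (theta i) (dv (theta i)))].

(* Integrals of vector functions are componentwise Lebesgue integrals. The
   library integral is total, so integrability is required separately. *)
Definition vintegrable (R : realType) (n : nat) (D : set R)
    (F : R -> 'cV[R]_n) : Prop :=
  forall i, (@lebesgue_measure R).-integrable D (fun s => (F s i 0)%:E).

Definition vintegral (R : realType) (n : nat) (D : set R)
    (F : R -> 'cV[R]_n) : 'cV[R]_n :=
  \col_i Rintegral (@lebesgue_measure R) D (fun s => F s i 0).

Definition is_lower_integral (R : realType) (n : nat) (b : R)
    (F : R -> 'cV[R]_n) (I : 'cV[R]_n) : Prop :=
  vintegrable `]-oo, b] F /\ I = vintegral `]-oo, b] F.

Definition is_oriented_integral (R : realType) (n : nat) (a b : R)
    (F : R -> 'cV[R]_n) (I : 'cV[R]_n) : Prop :=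
  if a <= b then vintegrable `[a, b] F /\ I = vintegral `[a, b] F
  else vintegrable `[b, a] F /\ I = - vintegral `[b, a] F.

Definition integral_solution (R : realType) (k q : nat) (beta : R -> R)
    (U : R -> R -> 'M[R]_k) (V : R -> R -> 'M[R]_q)
    (g : R -> 'cV[R]_(k + q) -> 'cV[R]_(k + q) -> 'cV[R]_(k + q))
    (t0 : R) (z : R -> 'cV[R]_(k + q)) : Prop :=
  let u t := usubmx (z t) in
  let v t := dsubmx (z t) in
  forall t,
    is_lower_integral t
      (fun s => U t s *m usubmx (g s (z s) (z (beta s)))) (u t) /\
    is_oriented_integral t0 t
      (fun s => V t s *m dsubmx (g s (z s) (z (beta s))))
      (v t - V t t0 *m v t0).

(* Main.v *)
(* Write x for u or v, W for U or V, and G(t) for the matching component of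
   g(t, z(t), z(beta(t))). Pulling back to time t0, put w(t) = W(t0, t) x(t) and
   h(t) = W(t0, t) G(t). By the cocycle identity, both the differential system
   and the integral equations express that w is a primitive of h, i.e. that the
   integral of h over [a, b] is w(b) - w(a) whenever a <= b. On
   [theta_i, theta_(i+1)[ the function G coincides with the function obtained by
   freezing beta at theta_i, which is continuous on the whole line, so the
   fundamental theorem of calculus applies piecewise in one direction and gives
   the derivatives (one-sided at theta_i) in the other. For the stable block,
   the bound on z for t <= t0 and the dichotomy estimate make w(t) and h(t)
   O(exp(sigma t)) at -oo, which identifies w(t) with the integral of h over
   ]-oo, t]. *)
Require Import Defs.
From HB Require Import structures.
From mathcomp Require Import all_boot all_order all_algebra.
From mathcomp Require Import all_classical all_reals all_analysis.
From mathcomp Require Import measurable_realfun lra.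

Set Implicit Arguments.
Unset Strict Implicit.
Unset Printing Implicit Defensive.

Import Order.TTheory GRing.Theory Num.Theory.
Import numFieldNormedType.Exports.

Local Open Scope classical_set_scope.
Local Open Scope ring_scope.

(** * Matrix-valued functions *)

Section matrix_calculus.
Context {R : realType}.

Lemma cvg_mxP (T : Type) (F : set_system T) (FF : Filter F) m n
    (M : T -> 'M[R]_(m, n)) (L : 'M[R]_(m, n)) :
  M x @[x --> F] --> L <-> forall i j, M x i j @[x --> F] --> L i j.
Proof.
split=> [ML i j|ML].
  exact: (cvg_comp _ _ ML (@coord_continuous R m n i j L)).
apply/cvgrPdist_le => e e0.
near=> x; rewrite /Num.Def.normr/= mx_normrE (bigmax_le _ (ltW e0))// => -[i j] _.
rewrite !mxE /=; move: i j; near: x.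
apply: filter_forall => i; apply: filter_forall => j.
by move/cvgrPdist_le : (ML i j); apply.
Unshelve. all: by end_near. Qed.

Lemma cvg_mulmx (T : Type) (F : set_system T) (FF : Filter F) m n p
    (M : T -> 'M[R]_(m, n)) (N : T -> 'M[R]_(n, p)) (L : 'M[R]_(m, n)) (L' : 'M[R]_(n, p)) :
  M x @[x --> F] --> L -> N x @[x --> F] --> L' ->
  M x *m N x @[x --> F] --> L *m L'.
Proof.
move=> /cvg_mxP ML /cvg_mxP NL; apply/cvg_mxP => i j.
under eq_fun do rewrite mxE; rewrite mxE.
apply: cvg_big => [|k _]; [exact: add_continuous|apply: cvgM]; [exact: ML|exact: NL].
Qed.

Lemma is_derive_mxP m n (M : R -> 'M[R]_(m, n)) t D :
  is_derive t (1 : R) M D <->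
  forall i j, is_derive t (1 : R) (fun x => M x i j) (D i j).
Proof.
split=> [[dM DE] i j|dM].
  apply: DeriveDef; first by move/derivable_mxP : dM; apply.
  by rewrite -DE (derive_mx dM) mxE.
have dM' : derivable M t 1 by apply/derivable_mxP => i j; case: (dM i j).
apply: DeriveDef => //; apply/matrixP => i j.
by rewrite derive_mx// mxE; case: (dM i j).
Qed.

Lemma is_derive_mulmx m n p (M : R -> 'M[R]_(m, n)) (N : R -> 'M[R]_(n, p)) t
    DM DN :
  is_derive t (1 : R) M DM -> is_derive t (1 : R) N DN ->
  is_derive t (1 : R) (fun x => M x *m N x) (DM *m N t + M t *m DN).
Proof.
move=> /is_derive_mxP dM /is_derive_mxP dN; apply/is_derive_mxP => i j.
have -> : (fun x => (M x *m N x) i j) =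
    \sum_k ((fun x => M x i k) * (fun x => N x k j)).
  by apply/funext => x; rewrite mxE fct_sumE.
have -> : (DM *m N t + M t *m DN) i j =
    \sum_k (M t i k *: DN k j + N t k j *: DM i k).
  rewrite !mxE -big_split; apply: eq_bigr => k _.
  by rewrite addrC [DM i k * _]mulrC.
by apply: is_derive_sum => k; exact: is_deriveM.
Qed.

Lemma derivable_prod (I : Type) (r : seq I) (h : I -> R -> R) (t : R) :
  (forall i, derivable (h i) t 1) -> derivable (fun x => \prod_(i <- r) h i x) t 1.
Proof.
move=> dh; elim: r => [|i r IHr].
  by under eq_fun do rewrite big_nil; exact: derivable_cst.
by under eq_fun do rewrite big_cons; exact: derivableM.
Qed.

Lemma derivable_sumr (I : Type) (r : seq I) (h : I -> R -> R) (t : R) :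
  (forall i, derivable (h i) t 1) -> derivable (fun x => \sum_(i <- r) h i x) t 1.
Proof.
move=> dh; elim: r => [|i r IHr].
  by under eq_fun do rewrite big_nil; exact: derivable_cst.
by under eq_fun do rewrite big_cons; exact: derivableD.
Qed.

Lemma derivable_det n (M : R -> 'M[R]_n) (t : R) :
  derivable M t 1 -> derivable (fun x => \det (M x)) t 1.
Proof.
move=> /derivable_mxP dM; rewrite /determinant.
apply: derivable_sumr => s.
by apply: derivableM; [exact: derivable_cst|exact: derivable_prod].
Qed.

(** By Cramer's rule the entries of the inverse are cofactors divided by the determinant, hence
    rational in the entries of [M]. Invertibility is asked at every point because [invmx] obeys this
    formula only on invertible matrices. *)
Lemma derivable_invmx n (M : R -> 'M[R]_n) (t : R) :
  (forall x, M x \in unitmx) -> derivable M t 1 ->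
  derivable (fun x => invmx (M x)) t 1.
Proof.
move=> uM dM; apply/derivable_mxP => i j.
have -> : (fun x => invmx (M x) i j) =
    (fun x => (\det (M x))^-1) * (fun x => cofactor (M x) j i).
  by apply/funext => x; rewrite /invmx uM !mxE.
apply: derivableM.
  apply: derivableV; last exact: derivable_det.
  by have := uM t; rewrite unitmxE unitfE.
rewrite /cofactor.
apply: derivableM; first exact: derivable_cst.
apply: derivable_det; apply/derivable_mxP => a b.
under eq_fun do rewrite !mxE.
by move/derivable_mxP : dM; apply.
Qed.

(** Once the inverse is known to be differentiable, the product rule applied to
    [invmx (M x) *m M x = 1] leaves a linear equation that determines its derivative. *)
Lemma is_derive_invmx n (M : R -> 'M[R]_n) (t : R) D :
  (forall x, M x \in unitmx) -> is_derive t (1 : R) M D ->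
  is_derive t (1 : R) (fun x => invmx (M x)) (- (invmx (M t) *m D *m invmx (M t))).
Proof.
move=> uM dM.
have dV : derivable (fun x => invmx (M x)) t 1.
  by apply: derivable_invmx => //; case: dM.
have dVE := derivableP dV.
set E := 'D_1 _ t in dVE.
have := is_derive_mulmx dVE dM.
have -> : (fun x => invmx (M x) *m M x) = cst 1%:M.
  by apply/funext => x; rewrite mulVmx.
move=> /(@derive_val _ _ _ _ _ _ _); rewrite derive_cst => /esym/eqP.
rewrite addr_eq0 => /eqP EM.
have -> : - (invmx (M t) *m D *m invmx (M t)) = E by rewrite -mulNmx -EM mulmxK.
exact: dVE.
Qed.

Lemma is_derive_mx_cst m n (M : R -> 'M[R]_(m, n)) s t :
  (forall x, is_derive x (1 : R) M 0) -> M s = M t.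
Proof.
move=> dM; apply/matrixP => i j.
apply: (@is_derive_0_is_cst _ (fun x => M x i j)) => x.
by have /is_derive_mxP/(_ i j) := dM x; rewrite mxE.
Qed.

Lemma is_derive_cvg m n (M : R -> 'M[R]_(m, n)) (t : R) D :
  is_derive t (1 : R) M D -> {for t, continuous M}.
Proof. by case=> dM _; apply: differentiable_continuous; exact/derivable1_diffP. Qed.

End matrix_calculus.

(** * Transition matrices: cocycle identity and derivatives in both arguments *)

Section transition.
Context {R : realType} {n : nat}.
Variables (B : R -> 'M[R]_n) (W : R -> R -> 'M[R]_n).
Hypothesis HW : transition_matrix B W.

(** Two fundamental matrices of the same system differ by a constant right factor:
    [invmx (W x r) *m W x s] has zero derivative in [x], and at [x = r] it equals [W r s]. *)
Lemma transition_comp t s r : W t s = W t r *m W r s.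
Proof.
have uW x y : W x y \in unitmx by have [/(_ x)[]] := HW y.
have dW x y : is_derive x (1 : R) (W ^~ y) (B x *m W x y).
  by have [/(_ x)[]] := HW y.
pose M x := invmx (W x r) *m W x s.
have dM x : is_derive x (1 : R) M 0.
  have := is_derive_mulmx (is_derive_invmx (fun y => uW y r) (dW x r)) (dW x s).
  rewrite mulNmx !mulmxA mulmxK ?uW//.
  by rewrite addNr.
have : M t = M r by exact: is_derive_mx_cst.
rewrite /M; have [_ ->] := HW r.
by rewrite invmx1 mul1mx => <-; rewrite mulKVmx.
Qed.

Lemma transitionK t s : W t s *m W s t = 1%:M.
Proof. by rewrite -transition_comp; have [_ ->] := HW t. Qed.

Lemma is_derive_transitionl t s :
  is_derive t (1 : R) (W ^~ s) (B t *m W t s).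
Proof. by have [/(_ t)[]] := HW s. Qed.

(** This is the adjoint equation. It holds because [W t] is the pointwise inverse of the solution
    [W ^~ t]. *)
Lemma is_derive_transitionr t s :
  is_derive s (1 : R) (W t) (- (W t s *m B s)).
Proof.
have uW x : W x t \in unitmx by have [/(_ x)[]] := HW t.
have WE : W t = (fun x => invmx (W x t)).
  by apply/funext => x; rewrite -[LHS](mulmxK (uW x)) transitionK mul1mx.
have := is_derive_invmx uW (is_derive_transitionl s t).
by rewrite -WE -(congr1 (fun f => f s) WE) !mulmxA -mulmxA transitionK mulmx1.
Qed.

End transition.

(** * Primitives of real functions *)

Section integration.
Context {R : realType}.
Notation mu := (@lebesgue_measure R).

Lemma integrable_disjU d (T : measurableType d) (nu : measure T R) (A B : set T)
    (f : T -> \bar R) :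
  measurable A -> measurable B -> [disjoint A & B] ->
  nu.-integrable A f -> nu.-integrable B f -> nu.-integrable (A `|` B) f.
Proof.
move=> mA mB AB /integrableP[mfA fA] /integrableP[mfB fB].
have mf : measurable_fun (A `|` B) f by apply/measurable_funU.
apply/integrableP; split => //.
rewrite ge0_integral_setU//; last exact: measurableT_comp.
by rewrite lte_add_pinfty.
Qed.

Lemma disj_itv (A C : itv_bound R) (b : itv_bound R) :
  [disjoint [set` Interval A b] & [set` Interval b C]].
Proof.
apply/disj_setPS => y [/=]; rewrite !itv_boundlr => /andP[_ yb] /andP[by_ _].
have := le_trans yb by_; rewrite bnd_simp.
by rewrite ltxx.
Qed.

Lemma integrable_set1 (a : R) (h : R -> R) : mu.-integrable `[a, a] (EFin \o h).
Proof.
apply: (@eq_integrable _ _ _ _ _ _ (EFin \o cst (h a))) => //.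
  by move=> x; rewrite set_itv1 inE => /= ->.
apply: continuous_compact_integrable; first exact: segment_compact.
by move=> x; exact: cst_continuous.
Qed.

(** The left bound [A] is arbitrary, so that bounded intervals and half-lines starting at -oo are
    treated together. *)
Lemma integrable_itv_cat (A : itv_bound R) (b c : R) (h : R -> R) :
  (A <= BRight b)%O -> b <= c ->
  mu.-integrable [set` Interval A (BRight b)] (EFin \o h) ->
  mu.-integrable `[b, c] (EFin \o h) ->
  mu.-integrable [set` Interval A (BRight c)] (EFin \o h).
Proof.
move=> Ab bc hA hb.
rewrite (@itv_bndbnd_setU _ _ _ (BRight b))//.
apply: integrable_disjU => //; first exact: disj_itv.
by apply: integrableS hb => //; exact: subset_itv_oc_cc.
Qed.

Lemma Rintegral_itv_cat (A : itv_bound R) (b c : R) (h : R -> R) :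
  (A <= BRight b)%O -> b <= c ->
  mu.-integrable [set` Interval A (BRight c)] (EFin \o h) ->
  Rintegral mu [set` Interval A (BRight c)] h =
  Rintegral mu [set` Interval A (BRight b)] h + Rintegral mu `[b, c] h.
Proof.
move=> Ab bc hA.
(* The point [b] lies in both intervals; removing it from [[b, c]] does not change the integral and
   makes the pieces disjoint. *)
rewrite -(@Rintegral_itv_obnd_cbnd _ b).
  by rewrite -(@Rintegral_itvB _ _ A _ b)// addrC subrK.
by apply: integrableS hA => //; exact: subset_itvr.
Qed.

(** The reflection s -> -s leads to an integral over [-x, +oo[, computed from an antiderivative that
    vanishes at +oo. As the integrand is nonnegative, the finite value also gives integrability. *)
Lemma Rintegral_expR_Ny (sigma x : R) : 0 < sigma ->
  mu.-integrable `]-oo, x] (fun s => (expR (sigma * s))%:E) /\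
  Rintegral mu `]-oo, x] (fun s => expR (sigma * s)) = expR (sigma * x) / sigma.
Proof.
move=> s0.
have sN0 : sigma != 0 by rewrite gt_eqF.
have ce (c : R) : continuous (fun s : R => expR (c * s)).
  move=> s; apply: continuous_comp; last exact: continuous_expR.
  by apply: cvgM; [exact: cvg_cst|exact: cvg_id].
(* An antiderivative of the reflected integrand exp(-sigma s). *)
pose F s := - (expR (- sigma * s) / sigma).
have dF s : is_derive s (1 : R) F (expR (- sigma * s)).
  have h1 : is_derive s (1 : R) (fun s : R => - sigma * s) (- sigma).
    have := is_deriveZ (- sigma) (is_derive_id s (1 : R)).
    by rewrite /GRing.scale/= mulr1.
  have := is_deriveN (is_deriveM (is_derive1_comp (is_derive_expR _) h1)
     (is_derive_cst (sigma^-1) s (1 : R))).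
  rewrite scaler0 add0r /GRing.scale/=.
  by rewrite mulrN mulrN opprK mulrCA mulVf ?mulr1.
have I : (\int[mu]_(s in `]-oo, x]) (expR (sigma * s))%:E)%E =
    (expR (sigma * x) / sigma)%:E.
  rewrite -{1}(opprK x) ge0_integration_by_substitutionNy; last 2 first.
  - exact: continuous_subspaceT.
  - by move=> y _; exact: expR_ge0.
  rewrite (_ : (expR (sigma * x) / sigma) = 0 - F (- x)); last first.
    by rewrite sub0r opprK mulrNN.
  rewrite EFinB -(@ge0_continuous_FTC2y _ (fun s => expR (- sigma * s)) F (- x) 0).
  - by apply: eq_integral => y _ /=; rewrite mulrN mulNr.
  - by move=> y _; exact: expR_ge0.
  - exact: continuous_subspaceT.
  - rewrite -oppr0 -[X in _ --> - X](mul0r sigma^-1).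
    apply: cvgN; apply: cvgM; last exact: cvg_cst.
    under eq_fun do rewrite mulNr.
    apply: (@cvg_comp _ _ _ (fun y => sigma * y) (fun y => expR (- y))
      _ (pinfty_nbhs R)); last exact: cvgr_expR.
    by apply: gt0_cvgMry => //; exact: cvg_id.
  - by move=> y _; case: (dF y).
  - apply: cvg_at_right_filter.
    by apply: differentiable_continuous; apply/derivable1_diffP; case: (dF (- x)).
  - by move=> y _; rewrite derive1E; case: (dF y).
split; last by rewrite /Rintegral I.
apply/integrableP; split.
  apply/measurable_EFinP; apply: measurable_funTS.
  exact: continuous_measurable_fun.
under eq_integral do rewrite gee0_abs ?lee_fin ?expR_ge0//.
by rewrite I ltry.
Qed.

End integration.

(** * Primitives described by their increments *)

Section increments.
Context {R : realType}.
Notation mu := (@lebesgue_measure R).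

Definition increment_on (h w : R -> R) (a b : R) : Prop :=
  mu.-integrable `[a, b] (EFin \o h) /\ Rintegral mu `[a, b] h = w b - w a.

(** An integral form of w' = h, which tolerates the jumps of [h] at the points of the partition. *)
Definition primitive (h w : R -> R) : Prop :=
  forall a b, a <= b -> increment_on h w a b.

Lemma increment_on_cat h w a b c : a <= b -> b <= c ->
  increment_on h w a b -> increment_on h w b c -> increment_on h w a c.
Proof.
move=> ab bc [iab vab] [ibc vbc].
have iac : mu.-integrable `[a, c] (EFin \o h).
  by apply: (integrable_itv_cat _ bc iab ibc); rewrite bnd_simp.
by split=> //; rewrite (@Rintegral_itv_cat _ _ b)// vab vbc addrC subrKA.
Qed.

Lemma increment_on_catl h w a b c : a <= b -> b <= c ->
  increment_on h w a b -> increment_on h w a c -> increment_on h w b c.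
Proof.
move=> ab bc [iab vab] [iac vac]; split.
  by apply: integrableS iac => //; apply: subset_itvr; rewrite bnd_simp.
by move: vac; rewrite (@Rintegral_itv_cat _ _ b)// vab => vac; lra.
Qed.

Lemma increment_on_catr h w a b c : a <= b -> b <= c ->
  increment_on h w a c -> increment_on h w b c -> increment_on h w a b.
Proof.
move=> ab bc [iac vac] [ibc vbc]; split.
  by apply: integrableS iac => //; apply: subset_itvl; rewrite bnd_simp.
by move: vac; rewrite (@Rintegral_itv_cat _ _ b)// vbc => vac; lra.
Qed.

(** Agreement with the continuous function [H] is asked on [[a, b[] only, because [h] may jump at
    the right end of a piece; one point does not affect the integral. *)
Lemma increment_on_FTC2 (h w H : R -> R) a b : a <= b ->
  continuous H -> continuous w ->
  (forall t, a <= t < b -> h t = H t) ->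
  (forall t, a < t < b -> is_derive t (1 : R) w (H t)) ->
  increment_on h w a b.
Proof.
rewrite le_eqVlt => /predU1P[<- _ _ _ _|ab cH cw hH dw].
  split; first exact: integrable_set1.
  by rewrite set_itv1 Rintegral_set1 subrr.
have iH : mu.-integrable `[a, b] (EFin \o H).
  apply: continuous_compact_integrable; first exact: segment_compact.
  exact: continuous_subspaceT.
have ihH : {in `[a, b[%classic, EFin \o H =1 EFin \o h}.
  by move=> t; rewrite inE /= in_itv/= => /hH ->.
have iH' : mu.-integrable `[a, b[ (EFin \o H).
  by apply: integrableS iH => //; exact: subset_itv_co_cc.
have ih' : mu.-integrable `[a, b[ (EFin \o h).
  by apply: eq_integrable iH' => // t /ihH ->.
split.
  (* The value [h b] is unconstrained, so the point [b] is split off and treated separately. *)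
  rewrite (@itv_bndbnd_setU _ _ _ (BLeft b)) ?bnd_simp//; last exact: ltW.
  apply: integrable_disjU => //; first exact: disj_itv.
  exact: integrable_set1.
rewrite -Rintegral_itv_bndo_bndc//.
have -> : Rintegral mu `[a, b[ h = Rintegral mu `[a, b[ H.
  by apply: eq_Rintegral => t /ihH [].
rewrite Rintegral_itv_bndo_bndc// /Rintegral.
rewrite (@continuous_FTC2 _ H w)//.
- exact: continuous_subspaceT.
- split.
  + by move=> t /[!in_itv]/= /dw[].
  + by apply: cvg_at_right_filter; exact: cw.
  + by apply: cvg_at_left_filter; exact: cw.
- by move=> t /[!in_itv]/= /dw[_ <-]; rewrite derive1E.
Qed.

(** Near [t], up to a constant, [w] is the integral of [h] from [t - 1], which is continuous in its
    upper limit. *)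
Lemma primitive_continuous h w : primitive h w -> continuous w.
Proof.
move=> hw t.
have ab : t - 1 <= t + 1 by rewrite lerD2l ge0_cp.
have [ih _] := hw _ _ ab.
have lt1 : t - 1 < t + 1 by rewrite ltrD2l gt0_cp.
have /(continuous_within_itvP _ lt1)[/(_ t) + _ _] :=
  parameterized_integral_continuous ab ih.
rewrite in_itv/= ltrBlDr !ltrDl ltr01 => /(_ isT) ct.
have E x : t - 1 <= x ->
    parameterized_integral mu (t - 1) x h = w x - w (t - 1).
  by move=> tx; have [] := hw _ _ tx.
rewrite (_ : w = (fun x => (w x - w (t - 1)) + w (t - 1))); last first.
  by apply/funext => x; rewrite subrK.
apply: cvgD; last exact: cvg_cst.
have t1 : t - 1 <= t by rewrite gerBl.
rewrite -E//; apply: cvg_trans ct; apply: near_eq_cvg.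
near=> x; rewrite E//; near: x; by apply: lt_le_nbhsr; rewrite gtrBl.
Unshelve. all: by end_near. Qed.

Variables (theta : int -> R).
Hypothesis theta_le : forall i, theta i <= theta (i + 1).
Hypothesis theta_cover : forall t, exists i, theta i <= t < theta (i + 1).

Lemma primitive_piecewise (h w : R -> R) (H : int -> R -> R) :
  continuous w -> (forall i, continuous (H i)) ->
  (forall i t, theta i <= t < theta (i + 1) -> h t = H i t) ->
  (forall i t, theta i < t < theta (i + 1) -> is_derive t (1 : R) w (h t)) ->
  primitive h w.
Proof.
move=> cw cH hH dw.
have piece i a b : theta i <= a -> a <= b -> b <= theta (i + 1) ->
    increment_on h w a b.
  move=> ia ab bi; apply: (@increment_on_FTC2 _ _ (H i)) => // t /andP[at_ tb].
    by apply: hH; rewrite (le_trans ia at_) (lt_le_trans tb bi).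
  rewrite -hH; first by apply: (dw i); rewrite (le_lt_trans ia at_) (lt_le_trans tb).
  by rewrite (ltW (le_lt_trans ia at_)) (lt_le_trans tb bi).
have theta_homo i (n : nat) : theta i <= theta (i + n%:Z).
  elim: n => [|n IHn]; first by rewrite addr0.
  by rewrite (le_trans IHn)// -addn1 PoszD addrA.
(* Intervals starting at a partition point are covered by induction on the number of pieces they may
   meet. *)
have from i (n : nat) b : theta i <= b -> b <= theta (i + n%:Z) ->
    increment_on h w (theta i) b.
  elim: n b => [|n IHn] b ib.
    rewrite addr0 => bi; have -> : b = theta i by apply/eqP; rewrite eq_le bi.
    by apply: (piece i) => //; exact: lexx.
  rewrite -addn1 PoszD addrA => bi.
  have [bn|/ltW nb] := leP b (theta (i + n%:Z)); first exact: IHn.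
  apply: (increment_on_cat _ nb) => //.
  - by apply: IHn.
  - exact: piece nb bi.
move=> a b ab.
have [i /andP[ia _]] := theta_cover a.
have [j /andP[_ bj]] := theta_cover b.
(* The number of pieces from index [i] to [j + 1], or 0 if [i] already lies beyond [j + 1]. *)
have ij : exists n : nat, theta (j + 1) <= theta (i + n%:Z).
  have [ij|ji] := leP i (j + 1).
    exists (absz (j + 1 - i)%R); rewrite gez0_abs ?subr_ge0//.
    by rewrite subrKC.
  exists 0%N; rewrite addr0.
  have := theta_homo (j + 1) (absz (i - (j + 1))%R).
  by rewrite gez0_abs ?subr_ge0 ?(ltW ji)// subrKC.
have [n jn] := ij.
have bn : b <= theta (i + n%:Z) by rewrite (le_trans _ jn)// ltW.
(* The increment over [[a, b]] is the difference of two increments that start at [theta i]. *)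
apply: (increment_on_catl ia ab); apply: (from i n) => //.
  exact: le_trans bn.
exact: le_trans ab.
Qed.

(** Since [H] is continuous on the whole line, its integral extends [w] from the piece [[a, b[] to a
    function with a two-sided derivative even at [a], which later supplies the right derivative
    there. *)
Lemma primitive_piece (h w H : R -> R) a b : primitive h w -> continuous H ->
  (forall t, a <= t < b -> h t = H t) ->
  exists Phi : R -> R,
    (forall t, a - 1 < t -> is_derive t (1 : R) Phi (H t)) /\
    (forall t, a <= t < b -> w t = Phi t).
Proof.
move=> hw cH hH.
have iH x y : mu.-integrable `[x, y] (EFin \o H).
  apply: continuous_compact_integrable; first exact: segment_compact.
  exact: continuous_subspaceT.
(* Integration starts at [a - 1] so that [a] is an interior point; the constant added below matches
   the values at [a]. *)
pose PH x := Rintegral mu `[a - 1, x] H.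
have a1 : a - 1 <= a by rewrite gerBl.
exists (fun x => PH x + (w a - PH a)); split.
  move=> t at1.
  have [dP PE] : derivable PH t 1 /\ derive1 PH t = H t.
    by apply: (@continuous_FTC1_closed _ H (a - 1) t (t + 1)) => //; [rewrite ltrDl|exact: cH].
  have dPH : is_derive t (1 : R) PH (H t) by apply: DeriveDef; rewrite // -derive1E.
  rewrite -[H t]addr0.
  exact: (is_deriveD dPH (is_derive_cst (w a - PH a) t (1 : R))).
move=> t /andP[a_t t_b].
have [ih wE] := hw _ _ a_t.
rewrite /PH (@Rintegral_itv_cat _ _ a t)//.
have -> : Rintegral mu `[a, t] H = Rintegral mu `[a, t] h.
  apply: eq_Rintegral => x; rewrite inE/= in_itv/= => /andP[ax xt].
  by rewrite hH// ax (le_lt_trans xt).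
by rewrite wE; lra.
Qed.

Lemma primitive_Ny (h w : R -> R) :
  (forall t, mu.-integrable `]-oo, t] (EFin \o h) /\
    w t = Rintegral mu `]-oo, t] h) ->
  primitive h w.
Proof.
move=> hw a b ab; rewrite /increment_on; have [ib ->] := hw b; have [ia ->] := hw a.
split; first by apply: integrableS ib => //; exact: subset_itvr.
by rewrite (@Rintegral_itv_cat _ -oo%O a b)//; lra.
Qed.

(* Both [w] and the integral from -oo decrease exponentially at -oo and have
   the same increments. *)
Lemma primitive_integral_Ny (h w : R -> R) (sigma C t0 : R) : 0 < sigma ->
  primitive h w ->
  (forall s, s <= t0 -> `|h s| <= C * expR (sigma * s)) ->
  (forall s, s <= t0 -> `|w s| <= C * expR (sigma * s)) ->
  forall t, mu.-integrable `]-oo, t] (EFin \o h) /\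
    w t = Rintegral mu `]-oo, t] h.
Proof.
move=> s0 hw hC wC.
have iCexp x : mu.-integrable `]-oo, x] (EFin \o (fun s => C * expR (sigma * s))).
  have [ie _] := Rintegral_expR_Ny x s0.
  rewrite (_ : _ \o _ = (fun s => C%:E * (expR (sigma * s))%:E)%E)//.
  exact: integrableZl.
(* The half-line is a countable union of the intervals [[t - n, t]], on each of which [h] is
   integrable. *)
have mh (t : R) : @measurable_fun _ _ (measurableTypeR R) _ `]-oo, t] (EFin \o h).
  rewrite itvNy_bnd_bigcup_BLeft; apply/measurable_fun_bigcup => // n.
  have [/integrableP[]//] : increment_on h w (t - n%:R) t.
  by apply: hw; rewrite gerBl.
(* Up to [t0] the exponential dominates [h]; beyond [t0] only a bounded interval is added. *)
have ih0 x : x <= t0 -> mu.-integrable `]-oo, x] (EFin \o h).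
  move=> xt0; apply: (le_integrable _ (mh x) _ (iCexp x)) => //= s.
  rewrite in_itv/= => sx; rewrite !lee_fin.
  by rewrite (le_trans (hC _ (le_trans sx xt0)))// ler_norm.
have ih t : mu.-integrable `]-oo, t] (EFin \o h).
  have [tt0|/ltW t0t] := leP t t0; first exact: ih0.
  apply: (integrable_itv_cat _ t0t) => //; first exact: ih0.
  by have [] := hw _ _ t0t.
split; first exact: ih.
pose I x := Rintegral mu `]-oo, x] h.
have wI a b : a <= b -> w b - I b = w a - I a.
  move=> ab; have [_ wab] := hw _ _ ab.
  by rewrite /I (@Rintegral_itv_cat _ _ a b)//; lra.
have IC x : x <= t0 -> `|I x| <= C * (expR (sigma * x) / sigma).
  move=> xt0; apply: (le_trans (le_normr_Rintegral _ (ih x))) => //.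
  have [ie <-] := Rintegral_expR_Ny x s0.
  rewrite -RintegralZl//; apply: le_Rintegral => //.
  - by have := integrable_norm (ih x).
  - by move=> s; rewrite /= in_itv/= => sx; apply: hC; exact: le_trans xt0.
have C0 : 0 <= C.
  have := le_trans (normr_ge0 _) (wC t0 (lexx _)).
  by rewrite pmulr_lge0// expR_gt0.
(* The sum of the bound C exp(sigma x) on [w] and the bound C exp(sigma x) / sigma on [I]. *)
pose D := C * (1 + sigma^-1).
have D0 : 0 <= D by rewrite mulr_ge0// addr_ge0// invr_ge0 ltW.
have small x : x <= t0 -> `|w t0 - I t0| <= D * expR (sigma * x).
  move=> xt0; rewrite (wI _ _ xt0).
  apply: (le_trans (ler_normB _ _)).
  apply: (le_trans (lerD (wC _ xt0) (IC _ xt0))).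
  by rewrite /D; lra.
(* The constant value of [w - I] is bounded by D exp(sigma x) for every [x <= t0], hence vanishes as
   x -> -oo. *)
have wI0 : w t0 - I t0 = 0.
  apply/eqP; rewrite -normr_eq0; apply/eqP/le_anti; rewrite normr_ge0 andbT.
  apply/ler_addgt0Pr => e e0; rewrite add0r.
  have cD : D * expR (sigma * x) @[x --> -oo%R] --> 0.
    rewrite -[X in _ --> X](mulr0 D); apply: cvgM; first exact: cvg_cst.
    apply/cvgNy_compNP => /=.
    under eq_fun do rewrite mulrN.
    apply: (@cvg_comp _ _ _ (fun y => sigma * y) (fun y => expR (- y))
      _ (pinfty_nbhs R)); last exact: cvgr_expR.
    by apply: gt0_cvgMry => //; exact: cvg_id.
  move/cvgrPdist_le : cD => /(_ _ e0) cD.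
  near (ninfty_nbhs R) => x.
  apply: (le_trans (small x _)); first by near: x; by apply: nbhs_ninfty_le; rewrite num_real.
  have : `|0 - D * expR (sigma * x)| <= e by near: x.
  by rewrite sub0r normrN ger0_norm// mulr_ge0// expR_ge0.
have [tt0|/ltW t0t] := leP t t0.
  by have := wI _ _ tt0; rewrite wI0 /I; lra.
by have := wI _ _ t0t; rewrite wI0 /I; lra.
Unshelve. all: by end_near. Qed.

End increments.

(** * Euclidean norm *)

Section euclidean_norm.
Context {R : realType}.

Lemma enorm_ge0 n (x : 'cV[R]_n) : 0 <= enorm x.
Proof. exact: sqrtr_ge0. Qed.

Lemma enorm0 n : enorm (0 : 'cV[R]_n) = 0.
Proof.
by rewrite /enorm big1 ?sqrtr0// => i _; rewrite mxE expr0n.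
Qed.

Lemma normr_le_enorm n (x : 'cV[R]_n) i : `|x i 0| <= enorm x.
Proof.
rewrite -sqrtr_sqr; apply: ler_wsqrtr.
rewrite (bigD1 i)//= lerDl; apply: sumr_ge0 => j _; exact: sqr_ge0.
Qed.

Lemma enorm_eq0 n (x : 'cV[R]_n) : enorm x = 0 -> x = 0.
Proof.
move=> x0; apply/colP => i; rewrite mxE; apply/eqP; rewrite -normr_le0.
by rewrite (le_trans (normr_le_enorm _ _))// x0.
Qed.

Lemma enormZ n (c : R) (x : 'cV[R]_n) : enorm (c *: x) = `|c| * enorm x.
Proof.
rewrite /enorm -sqrtr_sqr -sqrtrM ?sqr_ge0// mulr_sumr.
by congr Num.sqrt; apply: eq_bigr => i _; rewrite mxE exprMn.
Qed.

Lemma enorm_le_sum n (x : 'cV[R]_n) : enorm x <= \sum_i `|x i 0|.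
Proof.
have s0 : 0 <= \sum_i `|x i 0| by apply: sumr_ge0.
rewrite -(ger0_norm s0) -sqrtr_sqr; apply: ler_wsqrtr.
rewrite expr2 mulr_suml; apply: ler_sum => i _.
rewrite -real_normK ?num_real// expr2 ler_wpM2l//.
by rewrite (bigD1 i)//= lerDl sumr_ge0.
Qed.

Lemma enorm_mulmx_le_sum p n (A : 'M[R]_(p, n)) (x : 'cV[R]_n) :
  enorm (A *m x) <= (\sum_i \sum_j `|A i j|) * enorm x.
Proof.
apply: (le_trans (enorm_le_sum _)); rewrite mulr_suml; apply: ler_sum => i _.
rewrite mxE mulr_suml; apply: (le_trans (ler_norm_sum _ _ _)).
apply: ler_sum => j _; rewrite normrM ler_wpM2l//; exact: normr_le_enorm.
Qed.

(** A supremum is an upper bound only for a bounded set, so this crude entrywise bound is what makes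
    [opnorm] usable. *)
Lemma opnorm_has_ubound p n (A : 'M[R]_(p, n)) :
  has_ubound [set enorm (A *m x) | x in [set x : 'cV[R]_n | enorm x <= 1]].
Proof.
exists (\sum_i \sum_j `|A i j|) => _ [y /= y1 <-].
apply: (le_trans (enorm_mulmx_le_sum _ _)).
by rewrite ler_piMr// sumr_ge0// => i _; rewrite sumr_ge0.
Qed.

Lemma enorm_mulmx p n (A : 'M[R]_(p, n)) (x : 'cV[R]_n) :
  enorm (A *m x) <= opnorm A * enorm x.
Proof.
have [x0|xn0] := eqVneq (enorm x) 0.
  by rewrite (enorm_eq0 x0) mulmx0 !enorm0 mulr0.
have xp : 0 < enorm x by rewrite lt_def xn0 enorm_ge0.
rewrite -ler_pdivrMr//.
have -> : enorm (A *m x) / enorm x = enorm (A *m ((enorm x)^-1 *: x)).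
  by rewrite -scalemxAr enormZ ger0_norm ?invr_ge0 ?enorm_ge0// mulrC.
apply: ub_le_sup; first exact: opnorm_has_ubound.
exists ((enorm x)^-1 *: x) => //=.
by rewrite enormZ ger0_norm ?invr_ge0 ?enorm_ge0// mulVf.
Qed.

Lemma opnorm_ge0 p n (A : 'M[R]_(p, n)) : 0 <= opnorm A.
Proof.
rewrite -(@enorm0 p) -(mulmx0 1 A); apply: ub_le_sup.
  exact: opnorm_has_ubound.
by exists 0 => //=; rewrite enorm0.
Qed.

Lemma enorm_usubmx k q (x : 'cV[R]_(k + q)) : enorm (usubmx x) <= enorm x.
Proof.
apply: ler_wsqrtr; rewrite [leRHS]big_split_ord /=.
under eq_bigr do rewrite mxE.
by rewrite lerDl; apply: sumr_ge0 => i _; exact: sqr_ge0.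
Qed.

(** This passes from the library topology to the Euclidean norm, through the coordinates and the
    continuity of the square root at 0. *)
Lemma cvg_enorm0 (T : Type) (F : set_system T) (FF : Filter F) n
    (x : T -> 'cV[R]_n) (y : 'cV[R]_n) :
  x t @[t --> F] --> y -> enorm (x t - y) @[t --> F] --> 0.
Proof.
move=> /cvg_mxP xy.
have S0 : \sum_i ((x t - y) i 0) ^+ 2 @[t --> F] --> \sum_(i < n) (0 : R).
  apply: cvg_big => [|i _]; first exact: add_continuous.
  have xy0 : (x t - y) i 0 @[t --> F] --> y i 0 - y i 0.
    by under eq_fun do rewrite !mxE; apply: cvgB; [exact: xy|exact: cvg_cst].
  rewrite subrr in xy0.
  by under eq_fun do rewrite expr2; rewrite -[X in nbhs X](mul0r (0 : R)); apply: cvgM.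
rewrite big1// in S0.
by have := cvg_comp _ _ S0 (@sqrt_continuous R 0); rewrite sqrtr0.
Qed.

End euclidean_norm.

(** The Lipschitz bound is uniform in time: f(s, y(s)) - f(s, y(t)) tends to 0 with y(s) - y(t), and
    f(s, y(t)) tends to f(t, y(t)) by continuity in the first argument. *)
Lemma continuous_lipschitz_comp (R : realType) n (f : R -> 'cV[R]_n -> 'cV[R]_n)
    (l : R) (y : R -> 'cV[R]_n) :
  (forall t y1 y2, enorm (f t y1 - f t y2) <= l * enorm (y1 - y2)) ->
  (forall y, continuous (f ^~ y)) -> continuous y ->
  continuous (fun t => f t (y t)).
Proof.
move=> fl fc yc t; apply/cvg_mxP => i j; rewrite (ord1 j).
rewrite -[f t (y t) i 0]add0r.
have -> : (fun s => f s (y s) i 0) =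
    (fun s => (f s (y s) i 0 - f s (y t) i 0) + f s (y t) i 0).
  by apply/funext => s; rewrite subrK.
apply: cvgD; last by have /cvg_mxP := fc (y t) t; apply.
have e0 : l * enorm (y s - y t) @[s --> t] --> l * 0.
  by apply: cvgM; [exact: cvg_cst|exact: (cvg_enorm0 _ (yc t))].
rewrite mulr0 in e0.
apply/norm_cvg0P.
apply: (squeeze_cvgr _ (cvg_cst 0) e0).
near=> s; rewrite normr_ge0/=.
by have := le_trans (normr_le_enorm _ i) (fl s (y s) (y t)); rewrite !mxE.
Unshelve. all: by end_near. Qed.

(** * Constant matrices and vector integrals *)

Section vector_integration.
Context {R : realType}.
Notation mu := (@lebesgue_measure R).

Lemma vintegral_mulmx (A : itv_bound R) (b : itv_bound R) m n (C : 'M[R]_(m, n))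
    (F : R -> 'cV[R]_n) :
  vintegrable [set` Interval A b] F ->
  vintegrable [set` Interval A b] (fun s => C *m F s) /\
  vintegral [set` Interval A b] (fun s => C *m F s) =
    C *m vintegral [set` Interval A b] F.
Proof.
move=> iF; set D := [set` _] in iF *.
have mD : measurable D by exact: measurable_itv.
have iF' j : mu.-integrable D (EFin \o (fun s => F s j 0)) by exact: iF.
have iCF c j : mu.-integrable D (EFin \o (fun s => c * F s j 0)).
  rewrite (_ : _ \o _ = (fun s => c%:E * (F s j 0)%:E)%E)//.
  exact: integrableZl.
(* Integrability and value are proved together, by induction on a list of indices, because each step
   of additivity uses both. *)
have key (r : seq 'I_n) i :
    mu.-integrable D (EFin \o (fun s => \sum_(j <- r) C i j * F s j 0)) /\
    Rintegral mu D (fun s => \sum_(j <- r) C i j * F s j 0) =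
    \sum_(j <- r) C i j * Rintegral mu D (fun s => F s j 0).
  elim: r => [|j r [IH1 IH2]].
    have -> : (fun s => \sum_(j <- [::]) C i j * F s j 0) = cst 0.
      by apply/funext => s; rewrite big_nil.
    rewrite big_nil; split; first exact: integrable0.
    by rewrite /Rintegral integral0.
  have -> : (fun s => \sum_(j0 <- j :: r) C i j0 * F s j0 0) =
      (fun s => C i j * F s j 0 + \sum_(j <- r) C i j * F s j 0).
    by apply/funext => s; rewrite big_cons.
  rewrite big_cons; split; first by have := integrableD _ (iCF (C i j) j) IH1; apply.
  by rewrite RintegralD// IH2 RintegralZl.
split.
  move=> i; have [+ _] := key (index_enum 'I_n) i.
  by congr (mu.-integrable D _); apply/funext => s; rewrite /= mxE.
apply/colP => i; rewrite !mxE; have [_ E] := key (index_enum 'I_n) i.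
transitivity (Rintegral mu D (fun s => \sum_j C i j * F s j 0)).
  by congr (Rintegral mu D _); apply/funext => s; rewrite mxE.
by rewrite E; apply: eq_bigr => j _; rewrite mxE.
Qed.

End vector_integration.

(** * Variation of constants *)

Section vector_primitive.
Context {R : realType} {n : nat}.
Notation mu := (@lebesgue_measure R).
Implicit Types (h w F : R -> 'cV[R]_n) (I : 'cV[R]_n).

Lemma is_oriented_integral_mulmx m (C : 'M[R]_(m, n)) a b F I :
  is_oriented_integral a b F I ->
  is_oriented_integral a b (fun s => C *m F s) (C *m I).
Proof.
rewrite /is_oriented_integral; case: ifP => _ [iF ->].
  by have [iCF <-] := vintegral_mulmx C iF.
by rewrite mulmxN; have [iCF <-] := vintegral_mulmx C iF.
Qed.

Lemma is_lower_integral_mulmx m (C : 'M[R]_(m, n)) b F I :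
  is_lower_integral b F I ->
  is_lower_integral b (fun s => C *m F s) (C *m I).
Proof. by move=> [iF ->]; have [iCF <-] := vintegral_mulmx C iF. Qed.

Definition vprimitive h w : Prop :=
  forall i, primitive (fun s => h s i 0) (fun s => w s i 0).

(** Increments from the base point [t0] determine all others: those at [a] and [b] are added if [t0]
    lies between them and subtracted otherwise. *)
Lemma vprimitive_oriented t0 h w :
  vprimitive h w <-> forall t, is_oriented_integral t0 t h (w t - w t0).
Proof.
rewrite /is_oriented_integral; split=> [hw t|hw i].
  have [t0t|/ltW tt0] := leP t0 t.
    split=> [i|]; first by have [] := hw i _ _ t0t.
    by apply/colP => i; rewrite !mxE; have [_ ->] := hw i _ _ t0t.
  split=> [i|]; first by have [] := hw i _ _ tt0.
  apply/colP => i; rewrite !mxE; have [_ ->] := hw i _ _ tt0.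
  by rewrite opprB.
pose h' s := h s i 0; pose w' s := w s i 0.
have R0 t : t0 <= t -> increment_on h' w' t0 t.
  move=> t0t; have := hw t; rewrite t0t => -[ih /colP/(_ i)].
  by rewrite !mxE => wE; split=> //; exact: ih.
have L0 t : t < t0 -> increment_on h' w' t t0.
  move=> tt0; have := hw t; rewrite leNgt tt0 => -[ih /colP/(_ i)].
  rewrite !mxE => wE; split; first exact: ih.
  by rewrite -[LHS]opprK -wE opprB.
move=> a b ab; have [t0a|at0] := leP t0 a.
  by apply: (increment_on_catl t0a ab); apply: R0 => //; exact: le_trans ab.
have [t0b|bt0] := leP t0 b.
  by apply: (increment_on_cat (ltW at0) t0b); [exact: L0|exact: R0].
by apply: (increment_on_catr ab (ltW bt0)); exact: L0.
Qed.

Lemma vprimitive_lowerP h w :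
  (forall t, is_lower_integral t h (w t)) -> vprimitive h w.
Proof.
move=> hw i; apply: primitive_Ny => t; have [ih /colP/(_ i)] := hw t.
by rewrite mxE => wE; split; [exact: ih|].
Qed.

Lemma vprimitive_lower h w sigma C t0 : 0 < sigma ->
  vprimitive h w ->
  (forall s, s <= t0 -> enorm (h s) <= C * expR (sigma * s)) ->
  (forall s, s <= t0 -> enorm (w s) <= C * expR (sigma * s)) ->
  forall t, is_lower_integral t h (w t).
Proof.
move=> s0 hw hC wC t.
have key i := primitive_integral_Ny s0 (hw i)
  (fun s st0 => le_trans (normr_le_enorm (h s) i) (hC s st0))
  (fun s st0 => le_trans (normr_le_enorm (w s) i) (wC s st0)) t.
split=> [i|]; first by have [] := key i.
by apply/colP => i; rewrite mxE; have [_ ->] := key i.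
Qed.

Lemma vprimitive_continuous h w : vprimitive h w -> continuous w.
Proof.
move=> hw t; apply/cvg_mxP => i j; rewrite (ord1 j).
exact: (primitive_continuous (hw i)).
Qed.

Lemma vprimitive_piece h w (H : R -> 'cV[R]_n) a b :
  vprimitive h w -> continuous H -> (forall t, a <= t < b -> h t = H t) ->
  exists Phi : R -> 'cV[R]_n,
    (forall t, a - 1 < t -> is_derive t (1 : R) Phi (H t)) /\
    (forall t, a <= t < b -> w t = Phi t).
Proof.
move=> hw cH hH.
have key i := primitive_piece (hw i)
  (fun t => (cvg_mxP (nbhs_filter t) _ _).1 (cH t) i 0)
  (fun t atb => congr1 (fun M : 'cV[R]_n => M i 0) (hH t atb)).
have [phi phiP] := choice key.
exists (fun t => \col_i phi i t); split=> t at_.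
  apply/is_derive_mxP => i j; rewrite (ord1 j).
  have [/(_ t at_) + _] := phiP i.
  by congr (is_derive _ _ _ _); apply/funext => s; rewrite mxE.
by apply/colP => i; rewrite mxE; have [_ ->] := phiP i.
Qed.

Lemma is_derive_right (x : R -> 'cV[R]_n) t d :
  is_derive t (1 : R) x d -> is_right_derive x t d.
Proof.
move=> [dx <-]; rewrite /is_right_derive.
have : h^-1 *: (x (h *: (1 : R) + t) - x t) @[h --> 0^'] --> 'D_1 x t by exact: dx.
move=> /cvg_dnbhs_at_right.
by under eq_fun do rewrite [_ *: 1]mulr1 [_ + t]addrC.
Qed.

End vector_primitive.

(** * Inhomogeneous linear systems pulled back to time [t0] *)

Section linear_system.
Context {R : realType} {n : nat}.
Variables (B : R -> 'M[R]_n) (W : R -> R -> 'M[R]_n).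
Hypothesis HW : transition_matrix B W.
Variables (t0 : R) (G x : R -> 'cV[R]_n).
Let h s := W t0 s *m G s.
Let w s := W t0 s *m x s.

Let x_w t : x t = W t t0 *m w t.
Proof. by rewrite /w mulmxA (transitionK HW) mul1mx. Qed.

Let hE t : (fun s => W t s *m G s) = (fun s => W t t0 *m h s).
Proof.
by apply/funext => s; rewrite /h mulmxA -(transition_comp HW).
Qed.

Let hE' t : h = (fun s => W t0 t *m (W t s *m G s)).
Proof. by apply/funext => s; rewrite mulmxA -(transition_comp HW). Qed.

Let cW t s : {for s, continuous (W t)}.
Proof. exact: is_derive_cvg (is_derive_transitionr HW t s). Qed.

(** Multiplication by the constant matrix [W t t0], or by its inverse [W t0 t], passes under the
    integral, where the cocycle identity turns one integrand into the other. *)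
Lemma variation_oriented : vprimitive h w <->
  forall t, is_oriented_integral t0 t (fun s => W t s *m G s)
    (x t - W t t0 *m x t0).
Proof.
have w0 : w t0 = x t0 by rewrite /w; have [_ ->] := HW t0; rewrite mul1mx.
split=> [/(vprimitive_oriented t0) hw t|hx].
  by rewrite x_w -w0 -mulmxBr hE; exact: is_oriented_integral_mulmx.
apply/(vprimitive_oriented t0) => t.
have := is_oriented_integral_mulmx (W t0 t) (hx t).
rewrite -hE' mulmxBr -/(w t) mulmxA (transitionK HW) mul1mx.
by rewrite w0.
Qed.

Lemma variation_lower :
  (forall t, is_lower_integral t h (w t)) <->
  forall t, is_lower_integral t (fun s => W t s *m G s) (x t).
Proof.
split=> hw t.
  by rewrite x_w hE; exact: is_lower_integral_mulmx.
by rewrite (hE' t); exact: is_lower_integral_mulmx.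
Qed.

Variables (theta : int -> R) (H : int -> R -> 'cV[R]_n).
Hypothesis theta_le : forall i, theta i <= theta (i + 1).
Hypothesis theta_cover : forall t, exists i, theta i <= t < theta (i + 1).
Hypothesis GH : forall i t, theta i <= t < theta (i + 1) -> G t = H i t.

Lemma ode_vprimitive : continuous x -> (forall i, continuous (H i)) ->
  (forall i t, theta i < t < theta (i + 1) ->
    is_derive t (1 : R) x (B t *m x t + G t)) ->
  vprimitive h w.
Proof.
move=> cx cH dx i.
apply: (@primitive_piecewise _ theta theta_le theta_cover _ _
  (fun k s => (W t0 s *m H k s) i 0)).
- by move=> t; apply: (cvg_mxP _ _ _).1; apply: cvg_mulmx; [exact: cW|exact: cx].
- by move=> k t; apply: (cvg_mxP _ _ _).1; apply: cvg_mulmx; [exact: cW|exact: cH].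
- by move=> k t kt; rewrite /h (GH kt).
- move=> k t kt.
  have := is_derive_mulmx (is_derive_transitionr HW t0 t) (dx k t kt).
  (* The term - W B x from the adjoint equation cancels W B x from the system, which leaves [h]. *)
  rewrite mulmxDr mulNmx !mulmxA addKr => /is_derive_mxP; exact.
Qed.

Lemma vprimitive_continuous_solution : vprimitive h w -> continuous x.
Proof.
move=> /vprimitive_continuous cw t.
have -> : x = fun t => W t t0 *m w t by apply/funext => s; exact: x_w.
apply: cvg_mulmx; last exact: cw.
exact: is_derive_cvg (is_derive_transitionl HW t t0).
Qed.

(** On each piece [x] agrees with a function [y] that is differentiable also at and slightly before
    [theta i]. Inside the piece the agreement holds near each point; at [theta i] it holds to the
    right, enough for the right derivative. *)
Lemma vprimitive_ode : vprimitive h w -> (forall i, continuous (H i)) ->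
  (forall i t, theta i < t < theta (i + 1) ->
    is_derive t (1 : R) x (B t *m x t + G t)) /\
  (forall i, theta i < theta (i + 1) ->
    is_right_derive x (theta i) (B (theta i) *m x (theta i) + G (theta i))).
Proof.
move=> hw cH.
have piece i : exists y : R -> 'cV[R]_n,
    (forall t, theta i - 1 < t -> is_derive t (1 : R) y (B t *m y t + H i t)) /\
    (forall t, theta i <= t < theta (i + 1) -> x t = y t).
  have cWH : continuous (fun s => W t0 s *m H i s).
    by move=> t; apply: cvg_mulmx; [exact: cW|exact: cH].
  have [|Phi [dPhi wPhi]] := @vprimitive_piece _ _ _ _ _ (theta i) (theta (i + 1)) hw cWH.
    by move=> t it; rewrite /h (GH it).
  exists (fun t => W t t0 *m Phi t); split=> t it; last by rewrite x_w wPhi.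
  have := is_derive_mulmx (is_derive_transitionl HW t t0) (dPhi t it).
  by rewrite !mulmxA (transitionK HW) mul1mx.
split=> i.
  move=> t /andP[it ti]; have [y [dy xy]] := piece i.
  have it' : theta i <= t < theta (i + 1) by rewrite (ltW it).
  rewrite (GH it') xy//.
  apply: (@near_eq_is_derive _ _ _ y).
    near=> s; rewrite xy//; apply/andP; split.
      by near: s; exact: lt_le_nbhsr.
    by near: s; exact: lt_nbhsl.
  by apply: dy; rewrite (le_lt_trans _ it)// gerBl.
move=> ii; have [y [dy xy]] := piece i.
have it' : theta i <= theta i < theta (i + 1) by rewrite lexx.
rewrite (GH it') xy//.
have : is_right_derive y (theta i) (B (theta i) *m y (theta i) + H i (theta i)).
  by apply: is_derive_right; apply: dy; rewrite gtrBl.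
apply: cvg_trans; apply: near_eq_cvg; near=> e.
rewrite !xy//; apply/andP; split.
  by rewrite lerDl; near: e; exact: nbhs_right_ge.
rewrite -ltrBrDl; near: e; apply: nbhs_right_lt; by rewrite subr_gt0.
Unshelve. all: by end_near. Qed.

End linear_system.

Lemma partition_cover (R : realType) (theta : int -> R)
  (theta_incr : forall i j : int, i < j -> theta i < theta j)
  (theta_infty : forall C : R, exists i0 : nat, forall i : int,
     (i0 <= `|i|)%N -> C <= `|theta i|) (t : R) :
  exists i, theta i <= t < theta (i + 1).
Proof.
have theta_homo i j : i <= j -> theta i <= theta j.
  by rewrite le_eqVlt => /predU1P[->//|/theta_incr/ltW].
(* The term [|theta 0|], with monotonicity, forces the signs of [theta] at -n0 and n0; [|t|] then
   places [t] between them, and the 1 makes the inequalities strict. *)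
have [n0 tn0] := theta_infty (`|t| + `|theta 0| + 1).
have nn : (n0 <= `|- n0%:Z|)%N by rewrite abszN.
have lo : theta (- n0%:Z) <= t.
  have := tn0 _ nn; have : theta (- n0%:Z) <= theta 0 by apply: theta_homo; rewrite oppr_le0.
  have [?|?] := ger0P (theta (- n0%:Z)).
    by have := ler_norm (theta 0); have := normr_ge0 t; move=> *; lra.
  have := ler_norm (- t); have := normr_ge0 (theta 0).
  by rewrite normrN => *; lra.
have hi : t < theta n0%:Z.
  have := tn0 n0%:Z (leqnn _); have : theta 0 <= theta n0%:Z by apply: theta_homo.
  have [?|?] := ger0P (theta n0%:Z).
    by have := ler_norm t; have := normr_ge0 (theta 0); move=> *; lra.
  have := ler_norm (- theta 0); have := normr_ge0 t.
  by rewrite normrN => *; lra.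
have ex : exists m : nat, t < theta (- n0%:Z + m%:Z).
  exists (n0 + n0)%N; rewrite PoszD addrA addNr add0r; exact: hi.
(* The least [m] with [t] below the partition point is positive, and its predecessor gives the left
   end of the piece. *)
have [[|m] tm minm] := ex_minnP ex.
  by move: tm; rewrite addr0 ltNge lo.
exists (- n0%:Z + m%:Z); rewrite -addrA -PoszD addn1 tm andbT leNgt.
by apply/negP => /minm; rewrite ltnn.
Qed.

(** The constant [c] stands for Q(theta_i) z(theta_i), the delayed argument frozen on one piece. *)
Lemma continuous_reduced_term (R : realType) (n : nat) (Q : R -> 'M[R]_n)
  (f : R -> 'cV[R]_n -> 'cV[R]_n -> 'cV[R]_n) (l : R) (z : R -> 'cV[R]_n)
  (c : 'cV[R]_n) :
  (forall t, Q t \in unitmx) -> (forall t, derivable Q t 1) ->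
  (forall y w, continuous (fun t => f t y w)) ->
  (forall t y1 w1 y2 w2,
     enorm (f t y1 w1 - f t y2 w2) <= l * (enorm (y1 - y2) + enorm (w1 - w2))) ->
  continuous z ->
  continuous (fun t => invmx (Q t) *m f t (Q t *m z t) c).
Proof.
move=> uQ dQ fc fl zc t.
apply: cvg_mulmx.
  apply: (@is_derive_cvg _ _ _ (fun t => invmx (Q t))).
  by apply/derivableP; exact: derivable_invmx.
apply: (@continuous_lipschitz_comp _ _ (fun t y => f t y c) l (fun t => Q t *m z t)).
- move=> s y1 y2; apply: (le_trans (fl s y1 c y2 c)).
  by rewrite subrr enorm0 addr0.
- by move=> y; exact: fc.
- move=> s; apply: cvg_mulmx; last exact: zc.
  by apply: is_derive_cvg; apply/derivableP; exact: dQ.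
Qed.

Lemma continuous_col_mxP (R : realType) k q (z : R -> 'cV[R]_(k + q)) :
  continuous z <->
  continuous (fun t => usubmx (z t)) /\ continuous (fun t => dsubmx (z t)).
Proof.
split=> [zc|[uc vc] t].
  split=> t; apply/cvg_mxP => i j; rewrite mxE; under eq_fun do rewrite mxE;
    exact: ((cvg_mxP (nbhs_filter t) z (z t)).1 (zc t)).
apply/cvg_mxP => i j; case: (split_ordP i) => i' ->.
  have E s : z s (lshift q i') j = usubmx (z s) i' j by rewrite mxE.
  rewrite E; under eq_fun do rewrite E.
  exact: ((cvg_mxP (nbhs_filter t) _ _).1 (uc t)).
have E s : z s (rshift k i') j = dsubmx (z s) i' j by rewrite mxE.
rewrite E; under eq_fun do rewrite E.
exact: ((cvg_mxP (nbhs_filter t) _ _).1 (vc t)).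
Qed.

Theorem lemma2p2 (R : realType) (k q : nat)
  (theta : int -> R) (thetabar : R) (beta : R -> R)
  (A : R -> 'M[R]_(k + q)) (mu : R)
  (f : R -> 'cV[R]_(k + q) -> 'cV[R]_(k + q) -> 'cV[R]_(k + q)) (l : R)
  (X : R -> 'M[R]_(k + q)) (P : 'M[R]_(k + q)) (K sigma : R)
  (Q : R -> 'M[R]_(k + q)) (Bp : R -> 'M[R]_k) (Bm : R -> 'M[R]_q)
  (U : R -> R -> 'M[R]_k) (V : R -> R -> 'M[R]_q)
  (N alpha t0 : R) (z : R -> 'cV[R]_(k + q))
  (Htheta_incr : forall i j : int, i < j -> theta i < theta j)
  (Htheta_infty : forall C : R, exists i0 : nat, forall i : int,
     (i0 <= `|i|)%N -> C <= `|theta i|)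
  (Hthetabar : 0 < thetabar)
  (Htheta_gap : forall i : int, theta (i + 1) - theta i <= thetabar)
  (Hbeta : forall (i : int) (t : R),
     theta i <= t < theta (i + 1) -> beta t = theta i)
  (HA_cont : continuous A)
  (HA_bound : ereal_sup (range (fun t => (opnorm (A t))%:E)) = mu%:E)
  (Hf_cont : forall y w, continuous (fun t => f t y w))
  (Hf_zero : forall t, f t 0 0 = 0)
  (Hf_lip : forall t y1 w1 y2 w2,
     enorm (f t y1 w1 - f t y2 w2) <= l * (enorm (y1 - y2) + enorm (w1 - w2)))
  (HK : 0 < K) (Hsigma : 0 < sigma)
  (Hdichotomy : exp_dichotomy A X P K sigma)
  (Hsmall : let M := expR (mu * thetabar) in
     let m := expR (- (mu * thetabar)) in
     l * M * thetabar *
       (1 + M * (1 + l * thetabar) * expR (M * l * thetabar)) < m)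
  (HrankP : k = \rank P)
  (HQ : lyapunov_matrix Q)
  (Hdiag : forall t, block_mx (Bp t) 0 0 (Bm t) =
     invmx (Q t) *m A t *m Q t - invmx (Q t) *m derive1 Q t)
  (HU : transition_matrix Bp U)
  (HV : transition_matrix Bm V)
  (HU_est : forall t s, s <= t -> opnorm (U t s) <= K * expR (- sigma * (t - s)))
  (HV_est : forall t s, t <= s -> opnorm (V t s) <= K * expR (- sigma * (s - t)))
  (HN : 0 < N) (Halpha : 0 < alpha < sigma)
  (Hz : forall t, t <= t0 -> enorm (z t) <= N * expR (alpha * (t - t0))) :
  reduced_solution theta beta Bp Bm (reduced_term Q beta f) z
  <-> integral_solution beta U V (reduced_term Q beta f) t0 z.
Proof.
have [alpha0 alpha_sigma] := andP Halpha.
have theta_le i : theta i <= theta (i + 1) by apply/ltW/Htheta_incr; rewrite ltrDl.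
have theta_cover := partition_cover Htheta_incr Htheta_infty.
have [uQ dQ _ [C HC]] := HQ.
have QC t : opnorm (Q t) <= C by have [] := HC t.
have QVC t : opnorm (invmx (Q t)) <= C by have [] := HC t.
have C0 : 0 <= C := le_trans (opnorm_ge0 _) (QC 0).
pose G s := reduced_term Q beta f s (z s) (z (beta s)).
pose H i s := invmx (Q s) *m f s (Q s *m z s) (Q (theta i) *m z (theta i)).
have GH i t : theta i <= t < theta (i + 1) -> G t = H i t.
  by move=> it; rewrite /G /reduced_term (Hbeta _ _ it).
have Hc : continuous z -> forall i, continuous (H i).
  by move=> zc i; exact: continuous_reduced_term uQ dQ Hf_cont Hf_lip zc.
have zN t : t <= t0 -> enorm (z t) <= N.
  move=> tt0; apply: (le_trans (Hz _ tt0)); rewrite ler_piMr ?(ltW HN)//.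
  by rewrite -expR0 ler_expR pmulr_rle0// subr_le0.
(* A bound on [G] up to [t0]: the factor [C] comes from the inverse of [Q], each [C * N] from one of
   the two arguments of [f]. The absolute value is taken because no sign of [l] is assumed. *)
pose D := C * (`|l| * (C * N + C * N)).
have QzN t : t <= t0 -> enorm (Q t *m z t) <= C * N.
  move=> tt0; apply: (le_trans (enorm_mulmx _ _)).
  by apply: ler_pM; rewrite ?opnorm_ge0 ?enorm_ge0 ?zN.
have GD t : t <= t0 -> enorm (G t) <= D.
  move=> tt0; have [i it] := theta_cover t; rewrite (GH _ _ it) /H.
  have [it' _] := andP it.
  apply: (le_trans (enorm_mulmx _ _)).
  apply: ler_pM; rewrite ?opnorm_ge0 ?enorm_ge0//.
  rewrite -[f _ _ _]subr0 -(Hf_zero t); apply: (le_trans (Hf_lip _ _ _ _ _)).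
  rewrite !subr0; apply: (@le_trans _ _ (`|l| * (enorm (Q t *m z t) +
    enorm (Q (theta i) *m z (theta i))))).
    by rewrite ler_wpM2r ?addr_ge0 ?enorm_ge0// ler_norm.
  (* The delayed time satisfies [theta i <= t <= t0], so the bound on [z] applies there as well. *)
  by rewrite ler_wpM2l// lerD ?QzN// (le_trans it').
have Gu i t : theta i <= t < theta (i + 1) -> usubmx (G t) = usubmx (H i t).
  by move=> /GH ->.
have Gv i t : theta i <= t < theta (i + 1) -> dsubmx (G t) = dsubmx (H i t).
  by move=> /GH ->.
have Hcu (zc : continuous z) i : continuous (fun t => usubmx (H i t)).
  by have [] := (continuous_col_mxP _).1 (Hc zc i).
have Hcv (zc : continuous z) i : continuous (fun t => dsubmx (H i t)).
  by have [] := (continuous_col_mxP _).1 (Hc zc i).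
split.
- move=> [zc dz _].
  have [uc vc] := (continuous_col_mxP _).1 zc.
  have pu := ode_vprimitive HU t0 theta_le theta_cover Gu uc (Hcu zc)
    (fun i t it => (dz i t it).1).
  have pv := ode_vprimitive HV t0 theta_le theta_cover Gv vc (Hcv zc)
    (fun i t it => (dz i t it).2).
  move=> t; split; last exact: (variation_oriented HV t0 _ _).1 pv t.
  have E s : expR (- sigma * (t0 - s)) = expR (- (sigma * t0)) * expR (sigma * s).
    by rewrite -expRD; congr expR; lra.
  have D0 : 0 <= D by rewrite !mulr_ge0// addr_ge0// mulr_ge0// ltW.
  (* The dichotomy estimate for [U t0 s], read as a function of [s], gives the growth exp(sigma s).
     The sum [D + N] bounds both the forcing term and the solution, so one constant serves for
     both. *)
  have bound (y : 'cV[R]_k) s : s <= t0 -> enorm y <= D + N ->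
      enorm (U t0 s *m y) <= K * (D + N) * expR (- (sigma * t0)) * expR (sigma * s).
    move=> st0 yDN; apply: (le_trans (enorm_mulmx _ _)).
    rewrite -mulrA -E mulrAC; apply: ler_pM; rewrite ?opnorm_ge0 ?enorm_ge0//.
    exact: HU_est.
  apply: (variation_lower HU t0 (fun s => usubmx (G s))
    (fun s => usubmx (z s))).1.
  apply: (vprimitive_lower (t0 := t0) Hsigma pu) => s st0; apply: (bound _ _ st0);
    apply: (le_trans (enorm_usubmx _)).
    by apply: (le_trans (GD _ st0)); rewrite lerDl (ltW HN).
  by apply: (le_trans (zN _ st0)); rewrite lerDr.
- move=> Iz.
  have pu := vprimitive_lowerP ((variation_lower HU t0 _ _).2 (fun t => (Iz t).1)).
  have pv := (variation_oriented HV t0 _ _).2 (fun t => (Iz t).2).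
  have zc : continuous z.
    apply/continuous_col_mxP; split.
      exact: (vprimitive_continuous_solution HU pu).
    exact: (vprimitive_continuous_solution HV pv).
  have [du ru] := vprimitive_ode HU Gu pu (Hcu zc).
  have [dv rv] := vprimitive_ode HV Gv pv (Hcv zc).
  have lt1 i : theta i < theta (i + 1) by apply: Htheta_incr; rewrite ltrDl.
  split=> //.
  + by move=> i t it; split; [exact: du it|exact: dv it].
  + by move=> i; split; [exact: ru|exact: rv].
Qed.
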